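(* Let $P$ be a translation invariant one-dependent point process on $\mathbb{Z}$. For $k\ge1$ let $\rho_k$ be the probability that $k$ given consecutive integers all belong to the random set, and set $$R(z)=1+z+\sum_{k\ge1}\rho_k z^{k+1}.$$ Then $P$ is determinantal with translation invariant correlation kernel $K(x,y)=k(y-x)$, where (as formal Laurent series in $z$) $$\sum_{n\in\mathbb{Z}}k(n)z^n=\frac{1}{1-R(z)}.$$
   Context: A point process on $\mathbb{Z}$ is a probability measure on subsets $S$ of $\mathbb{Z}$; its correlation function is $\rho(A)=P\{S:S\supseteq A\}$ for finite $A\subseteq\mathbb{Z}$. It is one-dependent if $\rho(X\cup Y)=\rho(X)\rho(Y)$ for all finite $X,Y$ with $|x-y|\ge 2$ for all $x\in X,y\in Y$; it is translation invariant if $\rho(A+m)=\rho(A)$ for all finite $A$ and $m\in\mathbb{Z}$. It is determinantal with correlation kernel $K$ if $\rho(A)=\det(K(x,y))_{x,y\in A}$ for every finite $A\subseteq\mathbb{Z}$. *)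

(* Defs.v *)
From HB Require Import structures.
From mathcomp Require Import all_boot all_order all_algebra finmap.
From mathcomp Require Import all_classical all_reals all_analysis.

Set Implicit Arguments.
Unset Strict Implicit.
Unset Printing Implicit Defensive.

Import Order.TTheory GRing.Theory Num.Theory.

Local Open Scope classical_set_scope.
Local Open Scope ring_scope.

(* Events {S : x \in S}; they generate the product sigma-algebra on the
   subsets of Z. *)
Definition occupied (x : int) : set (set int) := [set S | S x].

Definition config := g_sigma_algebraType (range occupied).

Section PointProcess.
Variable R : realType.
Implicit Types (P : probability config R) (A X Y : {fset int}).

Definition rho P A : R := fine (P [set S : set int | [set` A] `<=` S]).

Definition one_dependent P : Prop :=
  forall X Y, (forall x y, x \in X -> y \in Y -> 2 <= `|x - y|) ->
    rho P (X `|` Y)%fset = rho P X * rho P Y.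

Definition translation_invariant P : Prop :=
  forall A (m : int), rho P [fset (x + m)%R | x in A]%fset = rho P A.

(* The rows and columns are indexed by an enumeration of A; the determinant does
   not depend on its order, and equals 1 for A empty. *)
Definition determinantal P (K : int -> int -> R) : Prop :=
  forall A, rho P A = \det (\matrix_(i < #|` A|, j < #|` A|) K A`_i A`_j).

(* The integers a, a + 1, ..., a + k - 1. *)
Definition consecutive (a : int) (k : nat) : {fset int} :=
  [fset (a + (val i)%:Z)%R | i in 'I_k]%fset.

End PointProcess.

(* A formal Laurent series is the function n |-> coefficient of z^n, required
   to vanish for all sufficiently negative n. *)
Section Laurent.
Variable R : realType.
Implicit Types f g : int -> R.

Definition is_laurent f : Prop := exists N : int, forall n, n < N -> f n = 0.

(* For Laurent series each of these sums has finitely many nonzero terms; the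
   \sum_(i \in _) of a family with infinite support would be 0. *)
Definition laurent_mul f g : int -> R :=
  fun n => \sum_(i \in [set: int]) f i * g (n - i).

Definition laurent_one : int -> R := fun n => (n == 0)%:R.

Definition is_laurent_inv f g : Prop :=
  [/\ is_laurent f, is_laurent g & laurent_mul f g = laurent_one].

(* R(z) = 1 + z + \sum_(k >= 1) rho_k z^(k+1), rho_k being read off the
   consecutive integers starting at a. *)
Definition Rseries (P : probability config R) (a : int) : int -> R :=
  fun n => match n with
           | Posz 0 => 1
           | Posz 1 => 1
           | Posz k.+1 => rho P (consecutive a k)
           | Negz _ => 0
           end.

End Laurent.

(* Main.v *)
(* For x_1 < ... < x_n the matrix (k(x_j - x_i)) vanishes below the subdiagonal,
   because k(m) = 0 for m < -1, and its subdiagonal entries are -1 or 0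
   according to whether the two points are adjacent or not.  Expanding it along
   its first row therefore only involves the run x, x + 1, ..., x + n of adjacent
   points at the start, and yields
   det = \sum_(j <= n) k(j) det(the points left after deleting x, ..., x + j).
   By one-dependence rho satisfies the same recursion: rho factors over the runs,
   and on a single run the recursion is the identity k(z) (1 - R(z)) = 1. *)
Require Import Defs.
From mathcomp Require Import all_boot all_order all_algebra finmap.
From mathcomp Require Import all_classical all_reals all_analysis.
From mathcomp Require Import perm zify.

Import Order.TTheory GRing.Theory Num.Theory.
Local Open Scope ring_scope.

(* Coefficients of 1 / (1 + d_1 z + d_2 z^2 + ...), from c_n down to c_0. *)
Fixpoint inv_coefs (R : pzRingType) (d : nat -> R) (n : nat) : seq R :=
  if n is m.+1 then
    let l := inv_coefs R d m in - (\sum_(i < m.+1) d i.+1 * l`_i) :: l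
  else [:: 1].

Lemma nth_inv_coefs (R : pzRingType) (d : nat -> R) (n i : nat) :
  (i <= n)%N -> (inv_coefs R d n)`_i = head 0 (inv_coefs R d (n - i)).
Proof.
elim: n i => [|n IHn] [|i] //= le_in; exact: IHn.
Qed.

(** As [d 0 = 1], the equation of index n isolates [c n] in terms of earlier coefficients. *)
Lemma series_inverse (R : pzRingType) (d : nat -> R) :
  d 0 = 1 -> exists c : nat -> R,
    forall n, \sum_(i < n.+1) d i * c (n - i)%N = (n == 0)%:R.
Proof.
move=> d0; exists (fun n => head 0 (inv_coefs R d n)) => -[|n].
  by rewrite big_ord1 d0 mul1r.
rewrite big_ord_recl d0 mul1r subn0 /=.
apply/eqP; rewrite addrC subr_eq0; apply/eqP/eq_bigr => i _.
by rewrite nth_inv_coefs 1?leq_ord // /bump /= add1n subSS.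
Qed.

(** Points are kept in a list so that a run can be peeled off its front. *)
Definition toeplitz_det (R : comPzRingType) (k : int -> R) (s : seq int) : R :=
  \det (\matrix_(i < size s, j < size s) k (s`_j - s`_i)).

(* A free first row r makes the first-column expansion recursive: deleting the
   second row of the matrix keeps its first row. *)
Definition bordered_det (R : comPzRingType) (r k : int -> R) (s : seq int) : R :=
  \det (\matrix_(i < size s, j < size s)
    if i == 0 :> nat then r s`_j else k (s`_j - s`_i)).

Lemma toeplitz_det_bordered (R : comPzRingType) (k : int -> R) (x : int)
    (s : seq int) :
  toeplitz_det R k (x :: s) = bordered_det R (fun y => k (y - x)) k (x :: s).
Proof. by congr (\det _); apply/matrixP => -[[|i] ?] j; rewrite !mxE. Qed.

(** Rows and columns undergo the same permutation, so its sign enters twice. *)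
Lemma toeplitz_det_perm (R : comPzRingType) (k : int -> R) (s t : seq int) :
  perm_eq s t -> toeplitz_det R k s = toeplitz_det R k t.
Proof.
move=> st; have sz := perm_size st.
have [p sE] : exists p : 'S_(size t), s = [seq t`_(p i) | i <- enum 'I_(size t)].
  have /(@tuple_permP _ _ s (in_tuple t)) [p ->] : perm_eq s (in_tuple t) by [].
  by exists p; apply: eq_map => i; rewrite (tnth_nth 0).
have nE (i : 'I_(size t)) : s`_i = t`_(p i).
  by rewrite sE (nth_map i) ?size_enum_ord // nth_ord_enum.
rewrite /toeplitz_det sz.
set M := \matrix_(i < size t, j < size t) k (t`_j - t`_i).
have -> : \matrix_(i < size t, j < size t) k (s`_j - s`_i) =
    row_perm p (col_perm p M).
  by apply/matrixP => i j; rewrite !mxE !nE.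
rewrite row_permE col_permE !det_mulmx !det_perm mulrCA odd_permV.
by rewrite -signr_addb addbb mulr1.
Qed.

Lemma toeplitz_det_nil (R : comPzRingType) (k : int -> R) :
  toeplitz_det R k [::] = 1.
Proof. exact: det_mx00. Qed.

Lemma bordered_det1 (R : comPzRingType) (r k : int -> R) (x : int) :
  bordered_det R r k [:: x] = r x.
Proof. by rewrite /bordered_det det_mx11 mxE. Qed.

(* Laplace expansion along the first column: below the first row it can only
   be nonzero in the second row, where it is k(-1) = -1 if y = x + 1. *)
Lemma bordered_det_cons2 (R : comPzRingType) (r k : int -> R) (x y : int)
    (s : seq int) :
  k (-1) = -1 -> (forall m : int, m < -1 -> k m = 0) ->
  path <%R x (y :: s) ->
  bordered_det R r k [:: x, y & s] =
    r x * toeplitz_det R k (y :: s) +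
    (y == x + 1)%:R * bordered_det R r k (y :: s).
Proof.
move=> k_sub k_lt /= /andP[xy ys].
rewrite /bordered_det (expand_det_col _ ord0) 2!big_ord_recl big1 ?addr0 /=.
  rewrite !mxE /cofactor /= expr0 mul1r expr1; congr (_ * _ + _).
    by congr (\det _); apply/matrixP => i j; rewrite !mxE.
  have -> : k (x - y) = - (y == x + 1)%:R.
    have [->|yx] := eqVneq y (x + 1); first by rewrite -k_sub; congr k; lia.
    by rewrite k_lt ?oppr0 //; lia.
  rewrite mulN1r mulrNN; congr (_ * \det _); apply/matrixP => -[[|i] ?] j.
    by rewrite !mxE.
  by rewrite !mxE.
move=> i _; rewrite !mxE /= k_lt ?mul0r //.
have /allP/(_ s`_i (mem_nth _ (ltn_ord i))) yi := order_path_min lt_trans ys.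
by suff : x - s`_i < -1; last lia.
Qed.

Fixpoint run (x : int) (n : nat) : seq int :=
  if n is m.+1 then x :: run (x + 1) m else [::].

Lemma mem_run (x : int) (n : nat) (y : int) :
  (y \in run x n) = (x <= y < x + n%:Z).
Proof.
by elim: n x => [|n IHn] x /=; rewrite ?in_nil ?in_cons ?IHn; lia.
Qed.

Lemma size_run (x : int) (n : nat) : size (run x n) = n.
Proof. by elim: n x => //= n IHn x; rewrite IHn. Qed.

(** The initial run is taken maximal: [x + n.+1] is a gap, which puts [t] at distance at least 2
    from the run. *)
Lemma run_decomposition (x : int) (s : seq int) : path <%R x s ->
  exists n t, [/\ x :: s = run x n.+1 ++ t, sorted <%R t &
    forall y, y \in t -> x + n.+1%:Z < y].
Proof.
elim: s x => [|y s IHs] x; first by exists 0%N, [::].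
move=> /= /andP[xy ys].
have [yx|yx] := eqVneq y (x + 1).
  have [n [t [sE t_sorted t_gt]]] := IHs y ys.
  exists n.+1, t; split=> //=; first by rewrite sE yx.
  by move=> z /t_gt; lia.
exists 0%N, (y :: s); split=> // z; rewrite in_cons => /orP[/eqP->|zs]; first lia.
have := order_path_min lt_trans ys => /allP/(_ z zs); lia.
Qed.

Lemma sorted_run_cat (x : int) (n : nat) (t : seq int) :
  sorted <%R t -> (forall y, y \in t -> x + n%:Z < y) ->
  sorted <%R (run x n ++ t).
Proof.
move=> t_sorted; elim: n x => [//|n IHn] x t_gt /=.
rewrite (path_sortedE lt_trans) IHn ?andbT => [|y /t_gt]; last lia.
apply/allP => y; rewrite mem_cat mem_run => /orP[|/t_gt]; lia.
Qed.

(** Iterates the first-column expansion along the run. The row [r] stays fixed while [x] advances,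
    and the gap before [t] stops the process. *)
Lemma bordered_det_run (R : comPzRingType) (r k : int -> R) (x : int) (n : nat)
    (t : seq int) :
  k (-1) = -1 -> (forall m : int, m < -1 -> k m = 0) ->
  sorted <%R t -> (forall y, y \in t -> x + n.+1%:Z < y) ->
  bordered_det R r k (run x n.+1 ++ t) =
    \sum_(j < n.+1) r (x + j%:Z) *
       toeplitz_det R k (run (x + j%:Z + 1) (n - j) ++ t).
Proof.
move=> k1 k_lt t_sorted; elim: n x => [|n IHn] x t_gt.
  have := sorted_run_cat x 1 t t_sorted t_gt.
  rewrite big_ord1 addr0 /=; case: t t_gt {t_sorted} => [|y t] t_gt xt.
    by rewrite bordered_det1 toeplitz_det_nil mulr1.
  rewrite bordered_det_cons2 //.
  have := t_gt y (mem_head _ _).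
  by case: eqP => [|_ _]; [lia | rewrite mul0r addr0].
have := sorted_run_cat x n.+2 t t_sorted t_gt.
rewrite [run x n.+2]/= [LHS]/= => xt.
rewrite bordered_det_cons2 // eqxx mul1r.
rewrite big_ord_recl subn0 addr0 -[x + 1 :: _]/(run (x + 1) n.+1 ++ t).
rewrite IHn => [|y /t_gt]; last lia.
congr (_ + _); apply: eq_bigr => j _.
by rewrite lift0 subSS intS -!addrA.
Qed.

Section OneDependent.
Variables (R : realType) (P : probability config R) (a : int).
Hypotheses (hinv : translation_invariant P) (hdep : one_dependent P).

Local Notation d n := (rho P (consecutive a n)).

Lemma rho_fset0 : rho P fset0 = 1.
Proof.
rewrite /rho (_ : [set S | _]%classic = setT) ?probability_setT //.
by apply/seteqP; split=> S // _ z /=; rewrite in_fset0.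
Qed.

Lemma consecutive_run (x : int) (n : nat) :
  consecutive x n = [fset z in run x n]%fset.
Proof.
apply/fsetP => y; rewrite inE /= mem_run; apply/imfsetP/idP => /=.
  by case=> i _ ->; have := ltn_ord i; lia.
move=> xy; have lt_yn : (absz (y - x)%R < n)%N by lia.
by exists (Ordinal lt_yn) => //=; lia.
Qed.

Lemma rho_consecutive (x : int) (n : nat) : rho P (consecutive x n) = d n.
Proof.
rewrite -(hinv (consecutive a n) (x - a)) !consecutive_run; congr (rho P _).
apply/fsetP => y; rewrite inE /= mem_run; apply/idP/imfsetP => /=.
  by move=> xy; exists (y - (x - a)); rewrite ?inE /= ?mem_run; lia.
by case=> z; rewrite inE /= mem_run => az ->; lia.
Qed.

Lemma rho_run_cat (x : int) (n : nat) (t : seq int) :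
  (forall y, y \in t -> x + n%:Z < y) ->
  rho P [fset z in run x n ++ t]%fset = d n * rho P [fset z in t]%fset.
Proof.
move=> t_gt; rewrite -(rho_consecutive x) consecutive_run -hdep.
  by congr (rho P _); apply/fsetP => z; rewrite !inE.
by move=> y z; rewrite !inE /= mem_run => yx /t_gt; lia.
Qed.

Lemma rho_toeplitz (k : int -> R) (s : seq int) :
  k (-1) = -1 -> (forall m : int, m < -1 -> k m = 0) ->
  (forall n, d n.+1 = \sum_(j < n.+1) k j%:Z * d (n - j)%N) ->
  sorted <%R s -> rho P [fset z in s]%fset = toeplitz_det R k s.
Proof.
move=> k1 k_lt k_rec; have [N] := ubnP (size s).
elim: N s => // N IHN [|x s] /= sz s_sorted.
  rewrite toeplitz_det_nil -rho_fset0; congr (rho P _).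
  by apply/fsetP => z; rewrite !inE.
have [n [t [sE t_sorted t_gt]]] := run_decomposition x s s_sorted.
rewrite toeplitz_det_bordered sE bordered_det_run // rho_run_cat // k_rec.
rewrite mulr_suml; apply: eq_bigr => -[j /= lt_jn] _.
(* The shortened run ends where the original did, so [t] is still separated from it and
   one-dependence applies again. *)
have t_gt_j y : y \in t -> x + j%:Z + 1 + (n - j)%:Z < y by move/t_gt; lia.
have -> : x + j%:Z - x = j%:Z by lia.
rewrite -IHN ?sorted_run_cat // ?rho_run_cat ?mulrA //.
have := congr1 size sE; rewrite !size_cat !size_run /=; lia.
Qed.

End OneDependent.

Theorem corollary7p3 (R : realType) (P : probability config R) (a : int)
  (hinv : translation_invariant P) (hdep : one_dependent P) :
  exists k : int -> R,
    is_laurent_inv (fun n => laurent_one R n - Rseries P a n) k /\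
    determinantal P (fun x y => k (y - x)).
Proof.
pose d n := rho P (consecutive a n).
have d0 : d 0%N = 1.
  rewrite /d consecutive_run -(rho_fset0 R P); congr (rho P _).
  by apply/fsetP => z; rewrite !inE.
have [c cE] := series_inverse R d d0.
have c0 : c 0%N = 1 by have := cE 0%N; rewrite big_ord1 d0 mul1r.
(* 1 - R(z) = - z \sum_n d_n z^n, so the inverse is - z^-1 \sum_n c_n z^n. *)
pose k (m : int) : R :=
  match m with Posz j => - c j.+1 | Negz 0 => - c 0%N | Negz _ => 0 end.
have kE (n : nat) : k (n%:Z - 1) = - c n.
  by case: n => [|n] //; rewrite intS addrC addKr.
have k_lt m : m < -1 -> k m = 0 by case: m => [//|[|n]].
exists k; split.
  pose f n : R := laurent_one R n - Rseries P a n.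
  have fE (n : nat) : f n.+1%:Z = - d n.
    (* The coefficient 1 of z in R agrees with [d 0]. *)
    by rewrite /f /laurent_one sub0r; case: n => //=; rewrite d0.
  have f_le m : m <= 0 -> f m = 0.
    case: m => [[|n]|n] //; rewrite /f /laurent_one ?subrr ?subr0 //.
  split; first by exists 0 => n /ltW; exact: f_le.
    by exists (-1).
  apply/funext => n.
  change (\sum_(i \in [set: int]%classic) f i * k (n - i) = (n == 0)%:R).
  have [n_ge0|n_lt0] := leP 0 n; last first.
    rewrite fsbig1 ?(lt_eqF n_lt0) // => i _; have [i_le|i_gt] := leP i 0.
      by rewrite f_le ?mul0r.
    by rewrite k_lt ?mulr0 //; lia.
  case: n n_ge0 => // n _.
  (* Only 1 <= i <= n + 1 contributes: [f i] vanishes for i <= 0, and [k (n - i)] for i > n + 1. *)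
  pose r := [seq i.+1%:Z | i <- iota 0 n.+1].
  rewrite (fsbigE r) //; first last.
  - move=> i _ /negP i_notin; have [i_le|i_gt] := leP i 0.
      by rewrite f_le ?mul0r.
    have [i_n|i_n] := leP i n.+1%:Z; last by rewrite k_lt ?mulr0 //; lia.
    by case: i_notin; apply/mapP; exists (absz i).-1; rewrite ?mem_iota; lia.
  - by rewrite map_inj_uniq ?iota_uniq // => i j [].
  rewrite big_mkcond (eq_bigr (fun i => f i * k (n%:Z - i))); last first.
    by move=> i _; rewrite in_setT.
  rewrite big_map -[iota 0 n.+1]/(index_iota 0 n.+1) big_mkord -[RHS]cE.
  apply: eq_bigr => -[i /= i_n] _.
  by rewrite fE (_ : n%:Z - i.+1%:Z = (n - i)%N%:Z - 1) ?kE ?mulrNN //; lia.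
move=> A.
have -> : \det (\matrix_(i < #|` A|, j < #|` A|) k (A`_j - A`_i)) =
  toeplitz_det R k A by [].
(* The enumeration of [A] need not be increasing, whereas the recursion needs sorted points. *)
have As := perm_sort <=%R A.
rewrite -(toeplitz_det_perm R k (sort <=%R A) A) ?As //.
rewrite -(rho_toeplitz R P a hinv hdep) //.
- congr (rho P _); apply/fsetP => z.
  by rewrite inE /= (perm_mem (introT permPl As)).
- by rewrite /= c0.
(* Coefficient n + 1 of the product of the series of [d] and [c] is 0; solve for its last term
   [d n.+1 * c 0], reverse the sum and use [k j = - c j.+1]. *)
- move=> n; change (d n.+1 = \sum_(j < n.+1) k j%:Z * d (n - j)%N).
  have := cE n.+1; rewrite big_ord_recr /= subnn c0 mulr1 => /eqP.
  rewrite addrC addr_eq0 => /eqP ->.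
  rewrite (reindex_inj rev_ord_inj) -sumrN /=; apply: eq_bigr => j _.
  by rewrite mulNr mulrC; congr (- (c _ * d _)); have := ltn_ord j; lia.
by rewrite sort_lt_sorted fset_uniq.
Qed.
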